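(* Let $f:\mathbb R^n\to\mathbb R\cup\{+\infty\}$ be proper and lower semicontinuous, and for every $\bar x\in\operatorname{dom} f$ let $f_{\bar x}$ be a local model function for $f$ around $\bar x$. Assume: (a) $f$ is bounded from below; (b) for every $\bar x\in\operatorname{dom} f$, $f_{\bar x}$ is bounded from below by an affine function; (c) $H:\mathbb R^n\to\mathbb R^{n\times n}_{\ge\mu}$ is continuous; (d) the sequence $(x^k)_{k\in\mathbb N}$ generated by the Model Proximal Quasi-Newton Method has at least one accumulation point; (e) there is a constant $L>0$ such that for all $\bar x\in\operatorname{dom} f$ and all $x$, $\partial g_{\bar x}(x)\subset L\,B_{\|x-\bar x\|}(0)$, where $g_{\bar x}:=f_{\bar x}-f$; (f) $f$ is locally Lipschitz continuous. Let $(x^k)_{k\in\mathbb N}$ be generated by the Model Proximal Quasi-Newton Method and let $(x^k)_{k\in K}$ be a subsequence converging to a point $x^*$. Then $x^*$ is a stationary point of $f$, i.e. $0\in\partial f(x^* )$.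
   Context: **Subdifferentials.** For $h:\mathbb R^n\to\mathbb R\cup\{+\infty\}$ and $\bar x\in\operatorname{dom}h=\{x: h(x)<\infty\}$, the regular subdifferential $\hat\partial h(\bar x)$ is the set of $v$ with $\liminf_{x\to\bar x,\,x\ne\bar x}\frac{h(x)-h(\bar x)-\langle v,x-\bar x\rangle}{\|x-\bar x\|}\ge 0$. The (limiting) subdifferential $\partial h(\bar x)$ is the set of $v$ for which there are $x^k\to\bar x$ with $h(x^k)\to h(\bar x)$ and $v^k\in\hat\partial h(x^k)$ with $v^k\to v$. Both are empty for $\bar x\notin\operatorname{dom}h$. A point $x\in\operatorname{dom}h$ is stationary for $h$ if $0\in\partial h(x)$. **Model functions.** A growth function is a differentiable $\omega:\mathbb R_+\to\mathbb R_+$ with $\omega(0)=\omega'_+(0)=0$ (right derivative). A local model function for $f$ around $\bar x\in\operatorname{dom}f$ is a proper lower semicontinuous $f_{\bar x}:\mathbb R^n\to\mathbb R\cup\{+\infty\}$ with $\operatorname{dom}f_{\bar x}=\operatorname{dom}f$ for which there is a growth function $\omega_{\bar x}$ (depending on $\bar x$) with $|f(x)-f_{\bar x}(x)|\le\omega_{\bar x}(\|x-\bar x\|)$ for all $x\in\operatorname{dom} f$ in some neighborhood of $\bar x$. The function $g_{\bar x}$ is regarded as a real-valued function on $\mathbb R^n$ that equals $f_{\bar x}-f$ on $\operatorname{dom}f$, so that $f_{\bar x}=g_{\bar x}+f$. **Notation.** $B_r(z)$ is the closed ball of radius $r\geq 0$ centered at $z$. $\mathbb R^{n\times n}_{\ge\mu}$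 is the set of symmetric $n\times n$ matrices with smallest eigenvalue $\ge\mu$. For positive definite $A$, $\|v\|_A=\sqrt{\langle Av,v\rangle}$. ''$f$ locally Lipschitz continuous'' means that around each point of $\operatorname{dom} f$, $f$ is finite and Lipschitz on a neighborhood in $\mathbb R^n$. **Model Proximal Quasi-Newton Method.** Parameters: $\tau>1$, $\mu>0$, $0<\gamma_{\min}\le\gamma_{\max}<\infty$, $\delta\in(0,\tfrac12)$, $H:\mathbb R^n\to\mathbb R^{n\times n}_{\ge\mu}$ continuous. Start with $x^0\in\operatorname{dom}f$. For $k=0,1,2,\dots$, as long as $x^k$ is not a stationary point of $f$: choose $\gamma_k^0\in[\gamma_{\min},\gamma_{\max}]$ and set $H_k:=H(x^k)$; for $i=0,1,2,\dots$ put $\gamma_{k,i}:=\tau^{i+1}\gamma_k^0$ and compute a (global) solution $x^{k,i}$ of $\min_x f_{x^k}(x)+\frac{\gamma_{k,i}}2\|x-x^k\|_{H_k}^2$, until $|f(x^{k,i})-f_{x^k}(x^{k,i})|\le\delta\frac{\gamma_{k,i}}2\|x^{k,i}-x^k\|_{H_k}^2$; with $i_k$ the terminal value of $i$, set $\gamma_k:=\gamma_{k,i_k}$ and $x^{k+1}:=x^{k,i_k}$. The generated sequence $(x^k)_{k\in\mathbb N}$ is understood to be infinite.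
   Formalization: The formal statement additionally requires each real-valued extension g_x̄ of f_x̄ − f to be lower semicontinuous on all of R^n (automatic on dom f, void if dom f = R^n); for extensions that are not lower semicontinuous outside dom f the claim fails. *)

(* Defs.v *)
From HB Require Import structures.
From mathcomp Require Import all_boot all_order all_algebra.
From mathcomp Require Import all_classical all_reals all_analysis.

Set Implicit Arguments.
Unset Strict Implicit.
Unset Printing Implicit Defensive.

Import Order.TTheory GRing.Theory Num.Theory.
Import numFieldNormedType.Exports.

Local Open Scope classical_set_scope.
Local Open Scope ring_scope.

(* The library's norm on matrices is the sup norm, so the Euclidean norm is
   introduced separately; both induce the library's topology on 'cV[R]_n. *)
Definition dot (R : realType) (n : nat) (u v : 'cV[R]_n) : R :=
  \sum_(i < n) u i 0 * v i 0.

Definition enorm (R : realType) (n : nat) (u : 'cV[R]_n) : R :=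
  Num.sqrt (dot u u).

Definition normA (R : realType) (n : nat) (A : 'M[R]_n) (v : 'cV[R]_n) : R :=
  Num.sqrt (dot (A *m v) v).

Definition eball (R : realType) (n : nat) (z : 'cV[R]_n) (r : R) :
  set 'cV[R]_n := [set x | enorm (x - z) <= r].

Definition sym_eig_ge (R : realType) (n : nat) (mu : R) : set 'M[R]_n :=
  [set A | A^T = A /\ forall a : R, eigenvalue A a -> mu <= a].

(* Functions into R U {+oo} are \bar R-valued; the exclusion of -oo is part of
   proper_fun. *)
Definition dom (R : realType) (n : nat) (h : 'cV[R]_n -> \bar R) :
  set 'cV[R]_n := [set x | (h x < +oo)%E].

Definition proper_fun (R : realType) (n : nat) (h : 'cV[R]_n -> \bar R) :
  Prop := (forall x, (-oo < h x)%E) /\ (exists x, dom h x).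

Definition regular_subdiff (R : realType) (n : nat) (h : 'cV[R]_n -> \bar R)
    (xbar : 'cV[R]_n) : set 'cV[R]_n :=
  [set v | dom h xbar /\
    (0 <= limf_einf (fun x => (h x - h xbar - (dot v (x - xbar))%:E)
                              / (enorm (x - xbar))%:E) xbar^')%E].

Definition subdiff (R : realType) (n : nat) (h : 'cV[R]_n -> \bar R)
    (xbar : 'cV[R]_n) : set 'cV[R]_n :=
  [set v | dom h xbar /\
    exists (x_ v_ : nat -> 'cV[R]_n),
      [/\ x_ k @[k --> \oo] --> xbar,
          h (x_ k) @[k --> \oo] --> h xbar,
          forall k, regular_subdiff h (x_ k) (v_ k)
        & v_ k @[k --> \oo] --> v]].

Definition stationary (R : realType) (n : nat) (h : 'cV[R]_n -> \bar R)
    (x : 'cV[R]_n) : Prop := dom h x /\ subdiff h x 0.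

(* omega is only meaningful on [0, +oo[; its values at negative arguments are
   unconstrained and never used. *)
Definition growth_function (R : realType) (omega : R -> R) : Prop :=
  [/\ forall t, 0 <= t -> 0 <= omega t,
      omega 0 = 0,
      forall t, 0 < t -> derivable omega t 1
    & (omega t - omega 0) / t @[t --> 0^'+] --> (0 : R)].

Definition local_model (R : realType) (n : nat) (f : 'cV[R]_n -> \bar R)
    (xbar : 'cV[R]_n) (fx : 'cV[R]_n -> \bar R) : Prop :=
  [/\ proper_fun fx,
      lower_semicontinuous fx,
      dom fx = dom f
    & exists2 omega : R -> R, growth_function omega &
        \forall x \near xbar, dom f x ->
          (`|f x - fx x| <= (omega (enorm (x - xbar)))%:E)%E].

Definition bounded_below (R : realType) (n : nat) (h : 'cV[R]_n -> \bar R) :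
  Prop := exists m : R, forall x, (m%:E <= h x)%E.

Definition affinely_minorized (R : realType) (n : nat)
    (h : 'cV[R]_n -> \bar R) : Prop :=
  exists (a : 'cV[R]_n) (b : R), forall x, ((dot a x + b)%:E <= h x)%E.

Definition locally_lipschitz (R : realType) (n : nat)
    (f : 'cV[R]_n -> \bar R) : Prop :=
  forall xbar, dom f xbar ->
    exists2 U, nbhs xbar U &
      (forall x, U x -> f x \is a fin_num) /\
      exists K : R, forall x y, U x -> U y ->
        `|fine (f x) - fine (f y)| <= K * enorm (x - y).

Definition global_minimizer (R : realType) (n : nat)
    (h : 'cV[R]_n -> \bar R) (y : 'cV[R]_n) : Prop :=
  forall z, (h y <= h z)%E.

(* One outer iteration from xk to xk1: ik is the terminal inner index and
   y i, for i <= ik, is the solution of the i-th subproblem.  fx is the model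
   function around xk and Hk the value H(xk). *)
Definition mpqn_step (R : realType) (n : nat) (tau gmin gmax delta : R)
    (f fx : 'cV[R]_n -> \bar R) (Hk : 'M[R]_n) (xk xk1 : 'cV[R]_n) : Prop :=
  exists (gamma0 : R) (ik : nat) (y : nat -> 'cV[R]_n),
    let gamma i := tau ^+ i.+1 * gamma0 in
    let accepted i :=
      (`|f (y i) - fx (y i)|
         <= (delta * (gamma i / 2) * normA Hk (y i - xk) ^+ 2)%:E)%E in
    [/\ gmin <= gamma0 <= gmax,
        forall i, (i <= ik)%N -> global_minimizer
          (fun x => fx x + (gamma i / 2 * normA Hk (x - xk) ^+ 2)%:E)%E (y i),
        forall i, (i < ik)%N -> ~ accepted i,
        accepted ik
      & xk1 = y ik].

(* The generated sequence is infinite: no iterate is stationary and every inner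
   loop terminates. *)
Definition mpqn_sequence (R : realType) (n : nat) (tau gmin gmax delta : R)
    (f : 'cV[R]_n -> \bar R) (fm : 'cV[R]_n -> 'cV[R]_n -> \bar R)
    (H : 'cV[R]_n -> 'M[R]_n) (x_ : nat -> 'cV[R]_n) : Prop :=
  dom f (x_ 0%N) /\
  forall k, ~ stationary f (x_ k) /\
    mpqn_step tau gmin gmax delta f (fm (x_ k)) (H (x_ k)) (x_ k) (x_ k.+1).

(* Main.v *)
(* On [dom f] the model is [f] plus the gap [g], whose subgradients at [z] have
   norm at most [L |z - xbar|].  A variational mean value inequality turns this
   into [|g z| <= 4 L |z - xbar|^2], so every trial stepsize parameter above a
   constant is accepted and the [gamma_k] stay bounded.  Sufficient decrease and
   the lower bound on [f] give [x_{k+1} - x_k -> 0].  A fuzzy sum rule at the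
   minimiser [x_{k+1}] of [f + g + gamma_k/2 |. - x_k|_H^2] then yields regular
   subgradients of [f] of norm [O(|x_{k+1} - x_k|)] at points close to
   [x_{k+1}]; along the subsequence these tend to [0] and the points to [x*]. *)
Require Import Defs.
From HB Require Import structures.
From mathcomp Require Import all_boot all_order all_algebra.
From mathcomp Require Import all_classical all_reals all_analysis.
From mathcomp Require Import ring lra.
Import Order.TTheory GRing.Theory Num.Theory.
Import numFieldNormedType.Exports.
Local Open Scope classical_set_scope.
Local Open Scope ring_scope.

(** * Euclidean inner product and norm on column vectors *)

Lemma mx_coord_le_norm (R : realType) m p (A : 'M[R]_(m, p)) i j :
  `|A i j| <= `|A|.
Proof.
rewrite [leRHS]/Num.norm/= mx_normrE; apply/bigmax_geP; right => /=.
by exists (i, j).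
Qed.

Section euclidean.
Context {R : realType} {n : nat}.
Implicit Types (u v w x y z c : 'cV[R]_n) (a b r : R).

Lemma dotC u v : dot u v = dot v u.
Proof. by apply: eq_bigr => i _; rewrite mulrC. Qed.

Lemma dotDl u v w : dot (u + v) w = dot u w + dot v w.
Proof. by rewrite /dot -big_split; apply: eq_bigr => i _; rewrite mxE mulrDl. Qed.

Lemma dotDr u v w : dot u (v + w) = dot u v + dot u w.
Proof. by rewrite dotC dotDl !(dotC u). Qed.

Lemma dotZl a u v : dot (a *: u) v = a * dot u v.
Proof. by rewrite /dot mulr_sumr; apply: eq_bigr => i _; rewrite mxE mulrA. Qed.

Lemma dotZr a u v : dot u (a *: v) = a * dot u v.
Proof. by rewrite dotC dotZl dotC. Qed.

Lemma dotNl u v : dot (- u) v = - dot u v.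
Proof. by rewrite -scaleN1r dotZl mulN1r. Qed.

Lemma dotNr u v : dot u (- v) = - dot u v.
Proof. by rewrite dotC dotNl dotC. Qed.

Lemma dot0r u : dot u 0 = 0.
Proof. by rewrite -(scale0r (0 : 'cV[R]_n)) dotZr mul0r. Qed.

Lemma dot_ge0 u : 0 <= dot u u.
Proof. by apply: sumr_ge0 => i _; rewrite -expr2 sqr_ge0. Qed.

Lemma dot_eq0 u : dot u u = 0 -> u = 0.
Proof.
move=> /eqP; rewrite psumr_eq0; last by move=> i _; rewrite -expr2 sqr_ge0.
move=> /allP h; apply/matrixP => i j; rewrite (ord1 j) mxE.
have := h i (mem_index_enum i).
by rewrite mulf_eq0 orbb => /eqP.
Qed.

Lemma dot_mulmx_sym (A : 'M[R]_n) u v : A^T = A ->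
  dot (A *m u) v = dot u (A *m v).
Proof.
move=> As; rewrite /dot.
transitivity (\sum_(i < n) \sum_(j < n) A i j * u j 0 * v i 0).
  by apply: eq_bigr => i _; rewrite mxE mulr_suml.
rewrite exchange_big; apply: eq_bigr => i _ /=.
rewrite mxE mulr_sumr; apply: eq_bigr => j _.
by rewrite -{1}As mxE; ring.
Qed.

Lemma enorm_sqr u : enorm u ^+ 2 = dot u u.
Proof. by rewrite sqr_sqrtr // dot_ge0. Qed.

Lemma enorm_ge0 u : 0 <= enorm u.
Proof. exact: sqrtr_ge0. Qed.

Lemma enorm0 : enorm (0 : 'cV[R]_n) = 0.
Proof. by rewrite /enorm dot0r sqrtr0. Qed.

Lemma enorm_eq0 u : (enorm u == 0) = (u == 0).
Proof.
apply/eqP/eqP => [h|->]; last exact: enorm0.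
by apply: dot_eq0; rewrite -enorm_sqr h expr0n.
Qed.

Lemma enorm_gt0 u : (0 < enorm u) = (u != 0).
Proof. by rewrite lt_def enorm_ge0 andbT enorm_eq0. Qed.

Lemma enormZ a u : enorm (a *: u) = `|a| * enorm u.
Proof.
by rewrite /enorm dotZl dotZr mulrA -expr2 sqrtrM ?sqr_ge0// sqrtr_sqr.
Qed.

Lemma enormN u : enorm (- u) = enorm u.
Proof. by rewrite -scaleN1r enormZ normrN1 mul1r. Qed.

Lemma enormBC u v : enorm (u - v) = enorm (v - u).
Proof. by rewrite -enormN opprB. Qed.

(** Cauchy-Schwarz: for nonzero vectors, expand the nonnegative square of
    [enorm v *: u - enorm u *: v] and cancel the factor [enorm u * enorm v]. *)
Lemma dot_le_enorm u v : dot u v <= enorm u * enorm v.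
Proof.
have [/eqP u0|u0] := boolP (enorm u == 0).
  move: (u0) => /eqP; rewrite enorm_eq0 => /eqP ->.
  by rewrite dotC dot0r enorm0 mul0r.
have [/eqP v0|v0] := boolP (enorm v == 0).
  move: (v0) => /eqP; rewrite enorm_eq0 => /eqP ->.
  by rewrite dot0r enorm0 mulr0.
have ab : 0 < enorm u * enorm v by rewrite mulr_gt0// lt_def enorm_ge0 andbT.
have := dot_ge0 (enorm v *: u - enorm u *: v).
rewrite !(dotDl, dotDr, dotNl, dotNr, dotZl, dotZr) -!enorm_sqr (dotC v u).
set a := enorm u in ab *; set b := enorm v in ab *; set d := dot u v.
by move=> h; rewrite -(ler_pM2l ab); nra.
Qed.

Lemma enormD u v : enorm (u + v) <= enorm u + enorm v.
Proof.
rewrite -(ler_pXn2r (n := 2)) ?nnegrE ?addr_ge0 ?enorm_ge0//.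
rewrite enorm_sqr dotDl !dotDr (dotC v u) sqrrD !enorm_sqr.
by have := dot_le_enorm u v; lra.
Qed.

Lemma enorm_dist z x y : enorm (x - y) <= enorm (x - z) + enorm (z - y).
Proof.
have -> : x - y = (x - z) + (z - y) by rewrite addrA subrK.
exact: enormD.
Qed.

Lemma coord_le_enorm u i : `|u i 0| <= enorm u.
Proof.
rewrite -(ler_pXn2r (n := 2)) ?nnegrE ?enorm_ge0//.
rewrite real_normK ?num_real// enorm_sqr /dot (bigD1 i)//= expr2 lerDl.
by apply: sumr_ge0 => j _; rewrite -expr2 sqr_ge0.
Qed.

Lemma norm_le_enorm u : `|u| <= enorm u.
Proof.
rewrite [leLHS]/Num.norm/= mx_normrE; apply/bigmax_leP; split.
  exact: enorm_ge0.
by move=> [i j] _ /=; rewrite (ord1 j) coord_le_enorm.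
Qed.

Lemma enorm_le_coord u r : (forall i, `|u i 0| <= r) -> 0 <= r ->
  enorm u <= n%:R * r.
Proof.
move=> h r0.
rewrite -(ler_pXn2r (n := 2)) ?nnegrE ?mulr_ge0 ?enorm_ge0// enorm_sqr.
apply: (@le_trans _ _ (\sum_(i < n) r ^+ 2)).
  apply: ler_sum => i _; rewrite -expr2 -real_normK ?num_real//.
  by rewrite ler_pXn2r ?nnegrE.
rewrite sumr_const card_ord -[_ *+ n]mulr_natl exprMn ler_wpM2r ?sqr_ge0//.
by rewrite -natrX ler_nat; case: (n) => // m; rewrite expnS leq_pmulr.
Qed.

Lemma enorm_le_norm u : enorm u <= n%:R * `|u|.
Proof. by apply: enorm_le_coord => // i; exact: mx_coord_le_norm. Qed.

(** A crude operator-norm bound: later estimates only need a constant that is uniform once the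
    entries are bounded. *)
Lemma enorm_mulmx (A : 'M[R]_n) u r : 0 <= r -> (forall i j, `|A i j| <= r) ->
  enorm (A *m u) <= n%:R * (n%:R * r) * enorm u.
Proof.
move=> r0 h; rewrite -mulrA.
apply: enorm_le_coord; last by rewrite !mulr_ge0// enorm_ge0.
move=> i; rewrite mxE (le_trans (ler_norm_sum _ _ _))//.
apply: (@le_trans _ _ (\sum_(j < n) r * enorm u)).
  apply: ler_sum => j _; rewrite normrM.
  by apply: ler_pM => //; exact: coord_le_enorm.
by rewrite sumr_const card_ord -[_ *+ n]mulr_natl mulrA.
Qed.

(** * Topology through Euclidean balls: continuity and compactness *)

(** The sup norm and [enorm] bound each other up to a factor [n], so topological facts can be
    handled with Euclidean balls. *)
Lemma enorm_nbhsP x (U : set 'cV[R]_n) :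
  nbhs x U <-> exists2 e : R, 0 < e & forall y, enorm (y - x) < e -> U y.
Proof.
split=> [/nbhs_ballP[e /= e0 h]|[e e0 h]].
  exists e => // y ye; apply: h; rewrite mx_norm_ball /ball_ /=.
  by rewrite distrC (le_lt_trans (norm_le_enorm _)).
(* Dividing by [n.+1] instead of [n] keeps the radius positive in dimension 0. *)
apply/nbhs_ballP; exists (e / n.+1%:R) => /=; first by rewrite divr_gt0.
move=> y; rewrite mx_norm_ball /ball_ /= distrC => ye; apply: h.
apply: le_lt_trans (enorm_le_norm _) _.
apply: (@le_lt_trans _ _ (n.+1%:R * `|y - x|)).
  by rewrite ler_wpM2r// ler_nat.
by rewrite mulrC -ltr_pdivlMr.
Qed.

Lemma enorm_near x r : 0 < r -> \forall y \near x, enorm (y - x) < r.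
Proof. by move=> r0; apply/enorm_nbhsP; exists r. Qed.

Lemma cvg_enormP (x_ : nat -> 'cV[R]_n) x :
  x_ k @[k --> \oo] --> x <->
  forall e : R, 0 < e -> \forall k \near \oo, enorm (x_ k - x) < e.
Proof.
split=> [h e e0|h]; first exact: h _ (enorm_near x _ e0).
by move=> U /enorm_nbhsP[e e0 eU]; near=> k; apply: eU; near: k; exact: h.
Unshelve. all: by end_near. Qed.

Lemma enorm_continuous c : continuous (fun z => enorm (z - c)).
Proof.
move=> x; apply/(@cvgrPdist_lt _ _ _ (nbhs x)) => e e0.
near=> y.
have xy : enorm (y - x) < e by near: y; exact: enorm_near.
have h1 := enorm_dist y x c; have h2 := enorm_dist x y c.
by rewrite ltr_norml; move: h1 h2; rewrite (enormBC x y); lra.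
Unshelve. all: by end_near. Qed.

Lemma enorm_sqr_continuous c : continuous (fun z => enorm (z - c) ^+ 2).
Proof.
move=> x; rewrite /GRing.exp/=.
by apply: (@cvgM _ _ (nbhs x)); exact: enorm_continuous.
Qed.

Lemma dot_mulmx_continuous (A : 'M[R]_n) c :
  continuous (fun z => dot (A *m (z - c)) (z - c)).
Proof.
have hc i : continuous (fun z : 'cV[R]_n => (z - c) i 0).
  move=> z; apply/(@cvgrPdist_lt _ _ _ (nbhs z)) => e e0.
  near=> y; have -> : (z - c) i 0 - (y - c) i 0 = (z - y) i 0.
    by rewrite !mxE; ring.
  apply: le_lt_trans (coord_le_enorm _ _) _.
  by rewrite enormBC; near: y; exact: enorm_near.
have key (F : set_system 'cV[R]_n) (FF : Filter F) z :
    (forall i, (w - c) i 0 @[w --> F] --> (z - c) i 0) ->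
    dot (A *m (w - c)) (w - c) @[w --> F] --> dot (A *m (z - c)) (z - c).
  move=> hF; rewrite /dot; apply: cvg_big => [|i _]; first exact: add_continuous.
  apply: cvgM; last exact: hF.
  under eq_fun do rewrite mxE; rewrite mxE.
  apply: cvg_big => [|j _]; first exact: add_continuous.
  by apply: cvgM; [exact: cvg_cst|exact: hF].
by move=> z; apply: (key (nbhs z)) => i; exact: hc.
Unshelve. all: by end_near. Qed.

Lemma eball_closed c r : closed (eball c r).
Proof.
have -> : eball c r = (fun z => enorm (z - c)) @^-1` [set t | t <= r] by [].
by apply: closed_comp => [x _|]; [exact: enorm_continuous|exact: closed_le].
Qed.

(** Heine-Borel for row vectors, carried over to columns by the continuity of transposition. *)
Lemma bounded_closed_compact_cV (A : set 'cV[R]_n) r :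
  (forall z, A z -> enorm z <= r) -> closed A -> compact A.
Proof.
move=> Ar Acl.
have trc : continuous (@trmx R 1 n).
  move=> x U [P xP PU]; exists (fun i j => P j i).
    by move=> i j; have := xP j i; rewrite mxE.
  by move=> y h; apply: PU => i j; rewrite mxE; exact: h.
have -> : A = @trmx R 1 n @` [set x | A x^T].
  apply/seteqP; split => [x Ax|x [y /= Ay <-//]].
  by exists x^T => //=; rewrite trmxK.
apply: continuous_compact; first exact: continuous_subspaceT.
apply: bounded_closed_compact; last first.
  have -> : [set x | A x^T] = @trmx R 1 n @^-1` A by [].
  by apply: closed_comp => // x _; exact: trc.
exists r; split; first exact: num_real.
move=> s rs x /= /Ar xr; apply/ltW/(le_lt_trans _ rs)/(le_trans _ xr).
apply: le_trans (norm_le_enorm _).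
rewrite [leLHS]/Num.norm/= mx_normrE; apply/bigmax_leP; split => // -[i j] _ /=.
by rewrite (ord1 i); have := mx_coord_le_norm _ _ _ x^T j 0; rewrite mxE.
Qed.

Lemma eball_compact c r : compact (eball c r).
Proof.
apply: (@bounded_closed_compact_cV _ (r + enorm c)); last exact: eball_closed.
move=> z; rewrite /eball/= => zr.
have -> : z = (z - c) + c by rewrite subrK.
by apply: le_trans (enormD _ _) _; rewrite lerD2r.
Qed.

End euclidean.

(** * Relative lower semicontinuity and attainment of minima *)

(** Semicontinuity is taken relative to [A] because [fine (f z)] is controlled only on a ball where
    [f] is finite. *)
Definition rlsc {R : realType} {T : topologicalType} (A : set T) (h : T -> R) :=
  forall p, A p -> forall e, 0 < e -> \forall q \near p, A q -> h p - e < h q.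

Section real_lsc.
Context {R : realType}.
Implicit Types T : topologicalType.

Lemma rlscD T (A : set T) (h k : T -> R) :
  rlsc A h -> rlsc A k -> rlsc A (fun q => h q + k q).
Proof.
move=> hA kA p Ap e e0; have e2 : 0 < e / 2 by rewrite divr_gt0.
near=> q => Aq.
have h1 : h p - e / 2 < h q by move: Aq; near: q; exact: hA.
have h2 : k p - e / 2 < k q by move: Aq; near: q; exact: kA.
by move: h1 h2; lra.
Unshelve. all: by end_near. Qed.

Lemma continuous_rlsc T (A : set T) (h : T -> R) : continuous h -> rlsc A h.
Proof.
move=> hc p _ e e0.
have : \forall q \near p, `|h p - h q| < e.
  by have /(@cvgrPdist_lt _ _ _ (nbhs p)) := hc p; exact.
by apply: filterS => q + _; rewrite ltr_norml; lra.
Qed.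

Lemma rlsc_comp T T' (A : set T) (B : set T') (j : T' -> T) (h : T -> R) :
  continuous j -> (forall q, B q -> A (j q)) -> rlsc A h -> rlsc B (h \o j).
Proof.
move=> jc BA hA p Bp e e0; near=> q => Bq.
by have := BA _ Bq; near: q; exact: (jc p _ (hA _ (BA _ Bp) _ e0)).
Unshelve. all: by end_near. Qed.

Lemma lsc_rlsc T (A : set T) (h : T -> R) :
  lower_semicontinuous (EFin \o h) -> rlsc A h.
Proof.
move=> hl p _ e e0.
have [|V pV hV] := hl p (h p - e); first by rewrite /= lte_fin ltrBlDr ltrDl.
by apply: filterS pV => q /hV + _; rewrite /= lte_fin.
Qed.

(** The sublevel sets [B w] are nested, hence generate a proper filter, which clusters at some [p]
    of [A]. If [h q < h p], then [h] stays above [h q] on [A] near [p], although [B q] meets every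
    neighbourhood of [p]. *)
Lemma rlsc_compact_min T (A : set T) (h : T -> R) (p0 : T) :
  compact A -> A p0 -> rlsc A h ->
  exists2 p, A p & forall q, A q -> h p <= h q.
Proof.
move=> cA Ap0 hA.
pose B w := [set z | A z /\ h z <= h w].
have FF : ProperFilter (filter_from A B).
  apply: filter_from_proper; last by move=> i Ai; exists i.
  apply: filter_from_filter; first by exists p0.
  move=> i j Ai Aj; have [ij|ji] := leP (h i) (h j).
    by exists i => // z [Az hz]; split; split => //; exact: le_trans ij.
  by exists j => // z [Az hz]; split; split => //; exact: le_trans (ltW ji).
have FA : filter_from A B A by exists p0 => // z [].
have [p [Ap clp]] := cA _ FF FA.
exists p => // q Aq; rewrite leNgt; apply/negP => hqp.
have hp : 0 < h p - h q by rewrite subr_gt0.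
have Bq : filter_from A B (B q) by exists q.
have [z [[Az hz]]] := clp _ _ Bq (hA p Ap _ hp).
by move=> /(_ Az); rewrite opprB addrC subrK ltNge hz.
Qed.

End real_lsc.

(* The upper part of a first-order expansion suffices for the Fermat rule, and
   it is stable under sums; the norm has it off the origin by AM-GM. *)
Definition upper_expansion {R : realType} {n : nat} (k : 'cV[R]_n -> R)
    (x v : 'cV[R]_n) :=
  exists C, \forall y \near x,
    k y <= k x + dot v (y - x) + C * enorm (y - x) ^+ 2.

(** * Quadratic upper expansions and the Fermat rule *)

Section subgradients.
Context {R : realType} {n : nat}.
Implicit Types (u v w x y z c : 'cV[R]_n) (k h : 'cV[R]_n -> R).

Lemma upper_expansionD k h x u v :
  upper_expansion k x u -> upper_expansion h x v ->
  upper_expansion (fun y => k y + h y) x (u + v).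
Proof.
move=> [C hC] [D hD]; exists (C + D); near=> y.
have h1 : k y <= k x + dot u (y - x) + C * enorm (y - x) ^+ 2 by near: y.
have h2 : h y <= h x + dot v (y - x) + D * enorm (y - x) ^+ 2 by near: y.
by rewrite dotDl; move: h1 h2; lra.
Unshelve. all: by end_near. Qed.

Lemma upper_expansionZ (a : R) k x v : 0 <= a -> upper_expansion k x v ->
  upper_expansion (fun y => a * k y) x (a *: v).
Proof.
move=> a0 [C hC]; exists (a * C); near=> y.
have h1 : k y <= k x + dot v (y - x) + C * enorm (y - x) ^+ 2 by near: y.
by rewrite dotZl; move: (ler_wpM2l a0 h1); lra.
Unshelve. all: by end_near. Qed.

Lemma enorm_sqr_expand x y c : enorm (y - c) ^+ 2 =
  enorm (x - c) ^+ 2 + 2 * dot (x - c) (y - x) + enorm (y - x) ^+ 2.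
Proof.
have -> : y - c = (x - c) + (y - x) by rewrite [RHS]addrC addrA subrK.
move: (x - c) (y - x) => a b.
by rewrite !enorm_sqr dotDl !dotDr (dotC b a); ring.
Qed.

Lemma upper_expansion_sqr x c :
  upper_expansion (fun y => enorm (y - c) ^+ 2) x (2 *: (x - c)).
Proof.
exists 1; near=> y; rewrite (enorm_sqr_expand x) dotZl mul1r.
by rewrite (enorm_sqr_expand x x) subrr enorm0 dot0r expr0n/= mulr0 !addr0.
Unshelve. all: by end_near. Qed.

Lemma upper_expansion_norm x c : x != c ->
  upper_expansion (fun y => enorm (y - c)) x ((enorm (x - c))^-1 *: (x - c)).
Proof.
move=> xc; have t0 : 0 < enorm (x - c) by rewrite enorm_gt0 subr_eq0.
(* With this constant the right-hand side is exactly [(s ^+ 2 + t ^+ 2) / (2 * t)], which is at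
   least [s] because [(s - t) ^+ 2] is nonnegative. *)
exists ((2 * enorm (x - c))^-1); near=> y.
have := enorm_sqr_expand x y c; rewrite dotZl.
set t := enorm (x - c) in t0 *; set s := enorm (y - c).
set d := dot _ _; set r := enorm (y - x) => E.
have -> : t + t^-1 * d + (2 * t)^-1 * r ^+ 2 = (s ^+ 2 + t ^+ 2) / (2 * t).
  by rewrite E; field; rewrite gt_eqF.
rewrite ler_pdivlMr ?mulr_gt0//.
by have := sqr_ge0 (s - t); lra.
Unshelve. all: by end_near. Qed.

(** The right-hand side is the square of [(Num.max 0 a - a) + b], whose first summand is
    nonnegative: it is at least [b ^+ 2] when [b] is nonnegative, and at least 0 otherwise. *)
Lemma sqr_max0_expand (a b : R) :
  Num.max 0 b ^+ 2 <= Num.max 0 a ^+ 2 + 2 * Num.max 0 a * (b - a) + (b - a) ^+ 2.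
Proof.
have -> : Num.max 0 a ^+ 2 + 2 * Num.max 0 a * (b - a) + (b - a) ^+ 2 =
  (Num.max 0 a - a) ^+ 2 + 2 * (Num.max 0 a - a) * b + b ^+ 2 by ring.
case: (leP 0 a) => a0; case: (leP 0 b) => b0.
- by rewrite subrr mulr0 mul0r expr0n/= !add0r.
- by rewrite subrr mulr0 mul0r expr0n/= !add0r sqr_ge0.
- by rewrite sub0r lerDr addr_ge0 ?sqr_ge0// !mulr_ge0// oppr_ge0 ltW.
- by have := sqr_ge0 (b - a); rewrite sub0r expr0n/=; lra.
Qed.

Lemma upper_expansion_barrier x c (s : R) :
  upper_expansion (fun y => Num.max 0 (enorm (y - c) ^+ 2 - s) ^+ 2) x
    ((4 * Num.max 0 (enorm (x - c) ^+ 2 - s)) *: (x - c)).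
Proof.
pose a := Num.max 0 (enorm (x - c) ^+ 2 - s).
have a0 : 0 <= a by rewrite le_max lexx.
(* The term [2 * a] absorbs the second-order part of the inner square. The other term bounds the
   squared inner increment, since that increment is at most [(2 * t + 1) * r] in absolute value when
   [r < 1]. *)
exists (2 * a + (2 * enorm (x - c) + 1) ^+ 2); near=> y.
have r1 : enorm (y - x) < 1 by near: y; exact: enorm_near.
apply: le_trans (sqr_max0_expand (enorm (x - c) ^+ 2 - s) _) _.
rewrite -/a dotZl (enorm_sqr_expand x y c).
have d1 := dot_le_enorm (x - c) (y - x).
have d2 := dot_le_enorm (- (x - c)) (y - x).
rewrite dotNl enormN in d2.
have r0 := enorm_ge0 (y - x); have t0 := enorm_ge0 (x - c).
set t := enorm (x - c) in d1 d2 t0 *; set r := enorm (y - x) in r0 r1 d1 d2 *.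
set d := dot _ _ in d1 d2 *.
have -> : t ^+ 2 + 2 * d + r ^+ 2 - s - (t ^+ 2 - s) = 2 * d + r ^+ 2 by ring.
have rr : r ^+ 2 <= r by rewrite expr2; nra.
have : (2 * d + r ^+ 2) ^+ 2 <= ((2 * t + 1) * r) ^+ 2.
  rewrite -[leLHS]real_normK ?num_real// ler_pXn2r ?nnegrE ?mulr_ge0 ?addr_ge0 ?mulr_ge0//.
  by have := sqr_ge0 r; rewrite ler_norml; lra.
by rewrite exprMn; lra.
Unshelve. all: by end_near. Qed.

Lemma upper_expansion_quad (A : 'M[R]_n) x c : A^T = A ->
  upper_expansion (fun y => dot (A *m (y - c)) (y - c)) x
    (2 *: (A *m (x - c))).
Proof.
move=> As.
pose r := \sum_i \sum_j `|A i j|.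
have r0 : 0 <= r by apply: sumr_ge0 => i _; apply: sumr_ge0.
have hA i j : `|A i j| <= r.
  rewrite /r (bigD1 i)//= (bigD1 j)//= -addrA lerDl addr_ge0//.
    by apply: sumr_ge0.
  by apply: sumr_ge0 => ? _; apply: sumr_ge0.
exists (n%:R * (n%:R * r)); near=> y.
have -> : y - c = (x - c) + (y - x) by rewrite [RHS]addrC addrA subrK.
move: (x - c) (y - x) => a b.
rewrite mulmxDr dotDl !dotDr dotZl (dot_mulmx_sym A b a As) (dotC b).
have := dot_le_enorm (A *m b) b.
have := ler_wpM2r (enorm_ge0 b) (enorm_mulmx A b r r0 hA).
by rewrite expr2; lra.
Unshelve. all: by end_near. Qed.

(** A quadratic minorant suffices, because the difference quotient is then at least
    [- C * enorm (y - x)]. The real representative [hr] confines extended-real arithmetic to this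
    proof. *)
Lemma regular_subdiffP (h : 'cV[R]_n -> \bar R) (hr : 'cV[R]_n -> R) x v C :
  (\forall y \near x, h y = (hr y)%:E) ->
  (\forall y \near x, hr x + dot v (y - x) - C * enorm (y - x) ^+ 2 <= hr y) ->
  regular_subdiff h x v.
Proof.
move=> hE hC; have hx : h x = (hr x)%:E by exact: nbhs_singleton hE.
split; first by rewrite /dom /= hx ltry.
rewrite limf_einfE.
suff H e : 0 < e -> ((- e)%:E <= ereal_sup [set ereal_inf ((fun y =>
   (h y - h x - (dot v (y - x))%:E) / (enorm (y - x))%:E)%E @` V) | V in x^'])%E.
  apply/lee_addgt0Pr => e e0; rewrite -[leLHS](@subee _ e%:E)// addeC.
  by rewrite leeD2r// -EFinN H.
move=> e0.
(* On this punctured neighbourhood the quotient stays above [- e]; adding 1 to [|C|] keeps the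
   radius meaningful for [C = 0]. *)
pose V := [set y | y != x /\ [/\ h y = (hr y)%:E,
  hr x + dot v (y - x) - C * enorm (y - x) ^+ 2 <= hr y &
  enorm (y - x) < e / (`|C| + 1)]].
have xV : x^' V.
  have e1 : 0 < e / (`|C| + 1) by rewrite divr_gt0// ltr_wpDl.
  near=> y; split; first by near: y; exact: nbhs_dnbhs_neq.
  split.
  - by near: y; exact: nbhs_dnbhs hE.
  - by near: y; exact: nbhs_dnbhs hC.
  - by near: y; apply: nbhs_dnbhs; exact: enorm_near.
apply: ereal_sup_ge; exists (ereal_inf ((fun y =>
   (h y - h x - (dot v (y - x))%:E) / (enorm (y - x))%:E)%E @` V)).
  by exists V.
apply: le_ereal_inf_tmp => _ [y [yx [-> h1 h2]] <-].
have r0 : 0 < enorm (y - x) by rewrite enorm_gt0 subr_eq0.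
rewrite hx inver gt_eqF//= -!EFinB -EFinM lee_fin ler_pdivlMr//.
move: h1 h2; rewrite ltr_pdivlMr; last by rewrite ltr_wpDl.
set r := enorm (y - x) in r0 *; have := ler_norm C; have := normr_ge0 C.
by nra.
Unshelve. all: by end_near. Qed.

(** Minimality bounds [hr y - hr x] below by [k x - k y], and the upper expansion of [k] turns this
    into a quadratic minorant of slope [- v]. *)
Lemma fermat_rule (h : 'cV[R]_n -> \bar R) (hr k : 'cV[R]_n -> R) x v :
  (\forall y \near x, h y = (hr y)%:E) ->
  (\forall y \near x, hr x + k x <= hr y + k y) ->
  upper_expansion k x v -> regular_subdiff h x (- v).
Proof.
move=> hE hm [C hC]; apply: (@regular_subdiffP h hr x _ C) => //.
near=> y.
have h1 : hr x + k x <= hr y + k y by near: y.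
have h2 : k y <= k x + dot v (y - x) + C * enorm (y - x) ^+ 2 by near: y.
by rewrite dotNl; move: h1 h2; lra.
Unshelve. all: by end_near. Qed.

End subgradients.

(** * Mean value inequality, fuzzy sum rule and coercivity *)

Section variational.
Context {R : realType} {n : nat}.
Implicit Types (u v w x y z c : 'cV[R]_n).

(* Minimise [g z + M |z - c|] plus a barrier that vanishes up to radius
   [|y - c|] and pushes minimisers off the sphere of radius [rho]: away from [c]
   a minimiser would carry a subgradient of norm at least [M]. *)
Lemma subgradient_mean_value (g : 'cV[R]_n -> R) c y (M rho : R) :
  lower_semicontinuous (EFin \o g) -> 0 < M -> enorm (y - c) < rho ->
  (forall z v, enorm (z - c) <= rho ->
     regular_subdiff (EFin \o g) z v -> enorm v < M) ->
  g c <= g y + M * enorm (y - c).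
Proof.
move=> gl M0 yr gM; have s0 := enorm_ge0 (y - c).
set s := enorm (y - c) in s0 yr *.
have Bc : eball c rho c by rewrite /eball/= subrr enorm0; lra.
have glB := lsc_rlsc _ (eball c rho) _ gl.
have [p Bp pmin] := rlsc_compact_min _ _ _ _ (eball_compact c rho) Bc glB.
have sr : 0 < rho ^+ 2 - s ^+ 2 by nra.
(* Scaled so that on the sphere of radius [rho] the barrier term equals [g c - g p]. As [g p] is the
   minimum of [g] on the ball, the objective there is at least [g c + M * rho], more than its value
   [g c] at the centre. *)
pose K := (g c - g p) / (rho ^+ 2 - s ^+ 2) ^+ 2.
have K0 : 0 <= K by rewrite divr_ge0 ?sqr_ge0// subr_ge0 pmin.
pose bar z := Num.max 0 (enorm (z - c) ^+ 2 - s ^+ 2) ^+ 2.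
pose k z := M * enorm (z - c) + K * bar z.
have bar_s z : enorm (z - c) <= s -> bar z = 0.
  move=> zs; rewrite /bar; have := enorm_ge0 (z - c) => z0.
  by case: (leP 0) => [h|_]; [have := ler_pM z0 z0 zs zs; rewrite -!expr2; nra
                             |rewrite expr0n].
have kc : k c = 0 by rewrite /k bar_s subrr enorm0 ?mulr0 ?addr0.
have barc : continuous bar.
  have h1 : continuous (fun z => enorm (z - c) ^+ 2 - s ^+ 2).
    move=> z; apply: (@cvgB _ _ _ (nbhs z)); last exact: cvg_cst.
    exact: enorm_sqr_continuous.
  have h2 : continuous (fun t : R => Num.max 0 t ^+ 2).
    move=> t; rewrite /GRing.exp/=.
    by apply: cvgM; apply: continuous_max; [exact: cvg_cst|exact: cvg_id|
       exact: cvg_cst|exact: cvg_id].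
  by move=> z; exact: cvg_comp (h1 z) (h2 _).
have kcont : continuous k.
  move=> z; apply: (@cvgD _ _ _ (nbhs z)).
    by apply: (@cvgM _ _ (nbhs z)); [exact: cvg_cst|exact: enorm_continuous].
  by apply: (@cvgM _ _ (nbhs z)); [exact: cvg_cst|exact: barc].
have [z0 Bz0 z0min] := rlsc_compact_min _ _ _ _ (eball_compact c rho) Bc
  (rlscD _ _ _ _ glB (continuous_rlsc _ (eball c rho) _ kcont)).
have z0c := z0min c Bc; rewrite kc addr0 in z0c.
have tr : enorm (z0 - c) < rho.
  rewrite lt_neqAle Bz0 andbT; apply/eqP => E.
  have kE : k z0 = M * rho + (g c - g p).
    rewrite /k /bar E (max_idPr _); last exact: ltW.
    by rewrite /K divfK// gt_eqF// exprn_gt0.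
  have := pmin _ Bz0; have : 0 < M * rho by apply: mulr_gt0 => //; exact: le_lt_trans yr.
  by move: z0c; rewrite kE; lra.
(* If the centre is the minimiser, comparison with [y], where the barrier vanishes, is already the
   claim. *)
have [E|z0nc] := eqVneq z0 c.
  have By : eball c rho y by exact: ltW.
  by have := z0min y By; rewrite E kc /k bar_s// mulr0 !addr0.
have t0 : 0 < enorm (z0 - c) by rewrite enorm_gt0 subr_eq0.
pose v := M *: ((enorm (z0 - c))^-1 *: (z0 - c)) +
          K *: ((4 * Num.max 0 (enorm (z0 - c) ^+ 2 - s ^+ 2)) *: (z0 - c)).
have ue : upper_expansion k z0 v.
  apply: upper_expansionD; apply: upper_expansionZ => //; first exact: ltW.
    exact: upper_expansion_norm.
  exact: upper_expansion_barrier.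
have : regular_subdiff (EFin \o g) z0 (- v).
  apply: (@fermat_rule _ _ _ g k) => //; first by near=> z.
  near=> z; apply: z0min; rewrite /eball/=; apply: ltW.
  have d1 := enorm_dist z0 z c.
  have : enorm (z - z0) < rho - enorm (z0 - c).
    by near: z; apply: enorm_near; rewrite subr_gt0.
  by move: d1; lra.
(* Norm and barrier contribute nonnegative multiples of the same vector [z0 - c], so nothing cancels
   and the subgradient has norm at least [M]. *)
move=> /(gM _ _ Bz0); rewrite enormN /v !scalerA -scalerDl enormZ.
set m := Num.max _ _.
have m0 : 0 <= m by rewrite le_max lexx.
have b0 : 0 <= K * (4 * m) by apply: mulr_ge0 => //; exact: mulr_ge0.
rewrite ger0_norm; last by rewrite addr_ge0// mulr_ge0 ?invr_ge0// ltW.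
rewrite mulrDl divfK ?gt_eqF//.
by have := mulr_ge0 b0 (ltW t0); lra.
Unshelve. all: by end_near. Qed.

(** The mean value inequality is applied in both directions on balls of radius [2 * s]. Around [a]
    subgradients are bounded by [2 * L * s], around [x] by [3 * L * s]; the factor 4 makes both
    bounds strict. *)
Lemma gap_quadratic_bound (g : 'cV[R]_n -> R) a (L : R) :
  lower_semicontinuous (EFin \o g) -> 0 < L ->
  (forall z v, regular_subdiff (EFin \o g) z v -> enorm v <= L * enorm (z - a)) ->
  forall x, `|g x - g a| <= 4 * L * enorm (x - a) ^+ 2.
Proof.
move=> gl L0 gL x; have [->|xa] := eqVneq x a.
  by rewrite !subrr enorm0 normr0 expr0n/= mulr0.
have s0 : 0 < enorm (x - a) by rewrite enorm_gt0 subr_eq0.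
pose s := enorm (x - a).
have M0 : 0 < 4 * L * s by rewrite !mulr_gt0.
have s2 : s < 2 * s by rewrite mulrC mulr_natr mulr2n ltrDl.
have h1 : g a <= g x + 4 * L * s * enorm (x - a).
  apply: (subgradient_mean_value _ _ _ _ _ gl M0 s2) => z v zr /gL.
  by move=> /le_lt_trans; apply; rewrite -/s in s0; nra.
have h2 : g x <= g a + 4 * L * s * enorm (a - x).
  apply: (@subgradient_mean_value _ _ _ _ (2 * s)) => //.
    by rewrite enormBC.
  move=> z v zr /gL /le_lt_trans; apply.
  have := enorm_dist x z a; rewrite -/s => zs.
  have : enorm (z - a) <= 3 * s by lra.
  by rewrite -/s in s0; nra.
rewrite (enormBC a) -/s in h2; rewrite -/s in h1 *.
by rewrite ler_norml; lra.
Qed.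

(* Doubling of variables: minimisers of
   [f z + g z' + k z' + N |z - z'|^2 + |z' - x|^2] near [x]. *)
Lemma fuzzy_sum_rule (f : 'cV[R]_n -> \bar R) (g k : 'cV[R]_n -> R)
    (dk : 'cV[R]_n -> 'cV[R]_n) x (eta : R) :
  locally_lipschitz f -> dom f x -> lower_semicontinuous (EFin \o g) ->
  continuous k -> (forall z, upper_expansion k z (dk z)) ->
  (forall z, dom f z -> fine (f x) + g x + k x <= fine (f z) + g z + k z) ->
  0 < eta ->
  exists z z' u, [/\ enorm (z - x) < eta, enorm (z' - x) < eta,
    regular_subdiff (EFin \o g) z' u
    & regular_subdiff f z (- (u + dk z' + 2 *: (z' - x)))].
Proof.
move=> fL fx gl kc ke xmin eta0.
have [U /enorm_nbhsP[r1 r10 r1U] [Ufin [K0 UK0]]] := fL x fx.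
pose r := Num.min (r1 / 2) (eta / 2).
have r0 : 0 < r by rewrite lt_min !divr_gt0.
have rr1 : r < r1.
  by apply: (@le_lt_trans _ _ (r1 / 2)); [rewrite ge_min lexx|lra].
have reta : r < eta.
  by apply: (@le_lt_trans _ _ (eta / 2)); [rewrite ge_min lexx orbT|lra].
pose K := `|K0| + 1.
have K1 : 0 < K by rewrite ltr_wpDl.
have BU z : enorm (z - x) <= r -> U z by move=> h; apply: r1U; lra.
pose fr z := fine (f z).
have fE z : U z -> f z = (fr z)%:E by move=> /Ufin/fineK.
have UK z y : U z -> U y -> `|fr z - fr y| <= K * enorm (z - y).
  move=> Uz Uy; apply: le_trans (UK0 _ _ Uz Uy) _.
  by rewrite ler_wpM2r ?enorm_ge0// /K; have := ler_norm K0; lra.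
(* The two summands secure [4 * K <= N * r] and [4 * K ^+ 2 <= N * r ^+ 2], which place [z] within
   [r / 4] of [z'] and [z'] within [r / 2] of [x]. *)
pose N := 4 * K ^+ 2 / r ^+ 2 + 4 * K / r.
have N0 : 0 < N by rewrite addr_gt0// divr_gt0 ?mulr_gt0// exprn_gt0.
have rn0 : r != 0 by rewrite gt_eqF.
have Nr : 4 * K <= N * r.
  have -> : N * r = 4 * K + 4 * K ^+ 2 / r by rewrite /N; field.
  by rewrite lerDl divr_ge0 ?mulr_ge0 ?sqr_ge0// ltW.
have Nr2 : 4 * K ^+ 2 <= N * r ^+ 2.
  have -> : N * r ^+ 2 = 4 * K ^+ 2 + 4 * K * r by rewrite /N; field.
  by rewrite lerDl !mulr_ge0// ltW.
pose B : set ('cV[R]_n * 'cV[R]_n) := eball x r `*` eball x r.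
have Bxx : B (x, x) by split; rewrite /eball/= subrr enorm0 ltW.
pose Phi (p : 'cV[R]_n * 'cV[R]_n) := fr p.1 + g p.2 + k p.2 +
  N * enorm (p.1 - p.2) ^+ 2 + enorm (p.2 - x) ^+ 2.
have cB : compact B by apply: compact_setX; exact: eball_compact.
have frl : rlsc (eball x r) fr.
  move=> p Bp e e0; near=> q => Bq.
  have := UK _ _ (BU _ Bp) (BU _ Bq); rewrite ler_norml => /andP[_ h].
  have : enorm (q - p) < e / K by near: q; apply: enorm_near; rewrite divr_gt0.
  by rewrite ltr_pdivlMr// enormBC mulrC => h'; move: h; lra.
have fstc : continuous (fun p : 'cV[R]_n * 'cV[R]_n => p.1).
  by move=> p; exact: cvg_fst.
have sndc : continuous (fun p : 'cV[R]_n * 'cV[R]_n => p.2).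
  by move=> p; exact: cvg_snd.
have sq := @enorm_sqr_continuous R n.
have difc : continuous (fun p : 'cV[R]_n * 'cV[R]_n => p.1 - p.2).
  move=> p; apply: (@cvgB _ _ _ (nbhs p)); [exact: cvg_fst|exact: cvg_snd].
have B1 q : B q -> eball x r q.1 by case.
have B2 q : B q -> eball x r q.2 by case.
have Phil : rlsc B Phi.
  have snd_rlsc (h : 'cV[R]_n -> R) : rlsc (eball x r) h -> rlsc B (fun p => h p.2).
    exact: (rlsc_comp _ _ _ _ _ h sndc B2).
  have pen : rlsc B (fun p => N * enorm (p.1 - p.2) ^+ 2).
    apply: continuous_rlsc => p; apply: (@cvgM _ _ (nbhs p)); first exact: cvg_cst.
    have := cvg_comp _ _ (difc p) (sq 0 _).
    by under eq_fun do rewrite /= subr0; rewrite subr0.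
  have fr1 := rlsc_comp _ _ _ _ _ fr fstc B1 frl.
  have g2 := snd_rlsc _ (lsc_rlsc _ _ _ gl).
  have k2 := snd_rlsc _ (continuous_rlsc _ _ _ kc).
  have x2 := snd_rlsc _ (continuous_rlsc _ _ _ (sq x)).
  exact: rlscD _ _ _ _ (rlscD _ _ _ _ (rlscD _ _ _ _ (rlscD _ _ _ _
    fr1 g2) k2) pen) x2.
have [[z z'] [/= Bz Bz'] zmin] := rlsc_compact_min _ _ _ _ cB Bxx Phil.
have Uz := BU _ Bz; have Uz' := BU _ Bz'.
have domU y : U y -> dom f y by move=> Uy; rewrite /dom/= fE// ltry.
have h1 := zmin (x, x) Bxx.
have h2 := xmin z' (domU _ Uz').
have h3 := UK _ _ Uz' Uz.
have d0 := enorm_ge0 (z - z'); have e0 := enorm_ge0 (z' - x).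
move: h1 h2 h3; rewrite /Phi /= !subrr !enorm0 expr0n/= -/(fr x) -/(fr z').
rewrite (enormBC z' z) => h1 h2 h3; have := ler_norm (fr z' - fr z) => h4.
(* Chain the minimality of [(z, z')] against [(x, x)] with that of [x] against [z']: the [g] and [k]
   terms cancel, leaving [fr z' - fr z], which the Lipschitz bound controls. *)
have key : N * enorm (z - z') ^+ 2 + enorm (z' - x) ^+ 2 <= K * enorm (z - z').
  by move: h1 h2 h3 h4; lra.
have d_small : enorm (z - z') <= r / 4.
  rewrite -(ler_pM2l N0); have [->|dn0] := eqVneq (enorm (z - z')) 0.
    by rewrite mulr0 mulr_ge0 ?divr_ge0// ltW.
  have : N * enorm (z - z') <= K.
    have dp : 0 < enorm (z - z') by rewrite lt_def dn0 d0.
    by rewrite -(ler_pM2r dp); have := sqr_ge0 (enorm (z' - x)); lra.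
  by lra.
have e_small : enorm (z' - x) <= r / 2.
  rewrite -(ler_pXn2r (n := 2)) ?nnegrE//; last by rewrite divr_ge0// ltW.
  rewrite -(ler_pM2l N0).
  have : N * enorm (z' - x) ^+ 2 <= K ^+ 2.
    have := sqr_ge0 (N * enorm (z - z') - K); have := sqr_ge0 (enorm (z - z')).
    by have := ler_wpM2l (ltW N0) key; have := mulr_ge0 (ltW K1) d0; nra.
  by rewrite exprMn exprVn; move: Nr2; lra.
have zx : enorm (z - x) < r.
  by have := enorm_dist z' z x; lra.
(* Both points lie strictly inside the ball, so minimality over the ball is local minimality, as the
   Fermat rule requires. *)
have interior y0 : enorm (y0 - x) < r ->
    \forall y \near y0, enorm (y - x) <= r.
  move=> y0r; near=> y; have d1 := enorm_dist y0 y x.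
  have : enorm (y - y0) < r - enorm (y0 - x).
    by near: y; apply: enorm_near; rewrite subr_gt0.
  by move: d1; lra.
have z'x : enorm (z' - x) < r by lra.
(* Minus the gradient in the second variable. Adding back the [k] and proximity terms leaves only
   the coupling gradient, which is what minimality in the first variable yields for [f]. *)
pose u := - (dk z' + N *: (2 *: (z' - z)) + 2 *: (z' - x)).
exists z, z', u; split; [lra|lra| |].
  apply: (@fermat_rule _ _ _ g (fun y =>
    k y + N * enorm (y - z) ^+ 2 + enorm (y - x) ^+ 2)).
  - by near=> y.
  - near=> y; have By : eball x r y by near: y; exact: interior.
    have := zmin (z, y) (conj Bz By); rewrite /Phi /= !(enormBC z); lra.
  - apply: upper_expansionD; last exact: upper_expansion_sqr.
    apply: upper_expansionD; first exact: ke.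
    by apply: upper_expansionZ; [exact: ltW|exact: upper_expansion_sqr].
have -> : u + dk z' + 2 *: (z' - x) = N *: (2 *: (z - z')).
  rewrite /u -[z - z']opprB !scalerN; move: (N *: _) (2 *: (z' - x)) => a b.
  by rewrite opprD opprD addrAC subrK addrAC addNr add0r.
apply: (@fermat_rule _ _ f fr (fun y => N * enorm (y - z') ^+ 2)).
- near=> y; apply: fE; apply: BU; near: y; exact: interior.
- near=> y; have By : eball x r y by near: y; exact: interior.
  by have := zmin (y, z') (conj By Bz'); rewrite /Phi /=; lra.
- by apply: upper_expansionZ; [exact: ltW|exact: upper_expansion_sqr].
Unshelve. all: by end_near. Qed.

(** The minimum [l] of the quadratic form on the unit sphere is an eigenvalue, hence at least [mu];
    homogeneity extends the bound to all vectors. *)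
Lemma sym_eig_ge_coercive (A : 'M[R]_n) (mu : R) : sym_eig_ge mu A ->
  forall v, mu * enorm v ^+ 2 <= dot (A *m v) v.
Proof.
move=> [As Aeig].
(* Without a unit vector (dimension 0) every vector is 0 and the bound is trivial. *)
have [[v0 v01]|nov] := pselect (exists v : 'cV[R]_n, enorm v = 1); last first.
  move=> v; have [->|vn0] := eqVneq v 0.
    by rewrite dot0r enorm0 expr0n/= mulr0.
  exfalso; apply: nov; exists ((enorm v)^-1 *: v).
  rewrite enormZ ger0_norm ?invr_ge0 ?enorm_ge0// mulVf//.
  by rewrite gt_eqF// enorm_gt0.
pose S := [set v : 'cV[R]_n | enorm v = 1].
have cS : compact S.
  apply: (@bounded_closed_compact_cV _ _ _ 1) => [z ->//|].
  have -> : S = (fun v => enorm (v - 0)) @^-1` [set t | t = 1].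
    by rewrite /S; apply/seteqP; split=> v /=; rewrite subr0.
  by apply: closed_comp => [v _|]; [exact: enorm_continuous|exact: closed_eq].
pose q v := dot (A *m v) v.
have qc : continuous q.
  have -> : q = (fun v => dot (A *m (v - 0)) (v - 0)).
    by apply/funext => v; rewrite subr0.
  exact: dot_mulmx_continuous.
have [v v1 vmin] := rlsc_compact_min _ _ _ _ cS v01 (continuous_rlsc _ S _ qc).
pose l := q v.
have ql w : l * enorm w ^+ 2 <= q w.
  have [->|wn0] := eqVneq w 0; first by rewrite /q dot0r enorm0 expr0n/= mulr0.
  have w0 : 0 < enorm w by rewrite enorm_gt0.
  have := vmin ((enorm w)^-1 *: w).
  rewrite /S/= enormZ ger0_norm ?invr_ge0 ?enorm_ge0// mulVf ?gt_eqF//.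
  move=> /(_ erefl); rewrite /q -scalemxAr dotZl dotZr mulrA -expr2 -/(q w) -/(q v) -/l.
  by rewrite exprVn mulrC ler_pdivlMr// exprn_gt0.
suff lmu : mu <= l.
  by move=> w; apply: le_trans (ql w); rewrite ler_wpM2r// sqr_ge0.
have E1 t a : enorm (v - t *: a) ^+ 2 = 1 - 2 * t * dot v a + t ^+ 2 * dot a a.
  rewrite enorm_sqr !(dotDl, dotDr, dotNl, dotNr, dotZl, dotZr).
  by rewrite -(enorm_sqr v) v1 (dotC a v); ring.
have E2 t a : q (v - t *: a) = l - 2 * t * dot (A *m v) a + t ^+ 2 * q a.
  rewrite /l /q mulmxBr -scalemxAr.
  rewrite !(dotDl, dotDr, dotNl, dotNr, dotZl, dotZr).
  by rewrite (dot_mulmx_sym A a v As) (dotC a); ring.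
(* [A - l] is positive semidefinite and its form vanishes at [v], so [v] is in
   its kernel. *)
pose w := A *m v - l *: v.
have wv : dot w w = 0.
  apply/eqP; rewrite eq_le dot_ge0 andbT leNgt; apply/negP => ww.
  pose b := q w - l * enorm w ^+ 2.
  have b0 : 0 <= b by rewrite subr_ge0.
  have st t : 0 <= - 2 * t * dot w w + t ^+ 2 * b.
    have := ql (v - t *: w); rewrite -subr_ge0.
    have -> // : q (v - t *: w) - l * enorm (v - t *: w) ^+ 2 =
              - 2 * t * dot w w + t ^+ 2 * b.
    have E3 : dot w w = dot (A *m v) w - l * dot v w.
      by rewrite {1}/w dotDl dotNl dotZl.
    by rewrite E1 E2 /b enorm_sqr E3; ring.
  (* A small step along [- w] makes the nonnegative form negative; [b + 1] replaces the minimising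
     denominator [b], which may be 0. *)
  have := st (dot w w / (b + 1)).
  have b1 : 0 < b + 1 by lra.
  set a := dot w w in ww *.
  have -> : - 2 * (a / (b + 1)) * a + (a / (b + 1)) ^+ 2 * b =
     - (a ^+ 2 * (b + 2) / (b + 1) ^+ 2) by field; rewrite gt_eqF.
  by rewrite oppr_ge0 leNgt divr_gt0 ?mulr_gt0 ?exprn_gt0//; lra.
have /eqP := dot_eq0 _ wv; rewrite subr_eq0 => /eqP Av.
(* Eigenvectors are row vectors here; the symmetry of [A] lets [v] be transposed. *)
apply: Aeig; apply/eigenvalueP; exists v^T.
  by rewrite -{1}As -trmx_mul Av linearZ.
apply/eqP => /(congr1 trmx); rewrite trmxK trmx0 => v0E.
by move: v1; rewrite /S/= v0E enorm0 => /esym/eqP; rewrite oner_eq0.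
Qed.

End variational.

(** * Approximate stationarity and the analysis of one outer iteration *)

Section algorithm.
Context {R : realType} {n : nat}.
Implicit Types (u v w x y z c : 'cV[R]_n) (f fx : 'cV[R]_n -> \bar R).

Lemma regular_subdiff_subdiff f x v : regular_subdiff f x v -> subdiff f x v.
Proof.
move=> h; split; first by case: h.
by exists (fun=> x), (fun=> v); split => //; exact: cvg_cst.
Qed.

(** Taking [e] to be the inverse of [k.+1] yields the two sequences; the local Lipschitz property
    supplies the convergence of function values demanded by the limiting subdifferential. *)
Lemma approx_stationary f x : locally_lipschitz f -> dom f x ->
  (forall e : R, 0 < e -> exists z w,
     [/\ enorm (z - x) < e, enorm w < e & regular_subdiff f z w]) ->
  stationary f x.
Proof.
move=> fL fx hx; split => //; split => //.
have e_ k : 0 < (k.+1%:R : R)^-1 by rewrite invr_gt0.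
have /choice[p pP] : forall k : nat, exists p : 'cV[R]_n * 'cV[R]_n,
    [/\ enorm (p.1 - x) < k.+1%:R^-1, enorm p.2 < k.+1%:R^-1
      & regular_subdiff f p.1 p.2].
  by move=> k; have [z [w ?]] := hx _ (e_ k); exists (z, w).
have e_small (e : R) : 0 < e -> \forall k \near \oo, (k.+1%:R : R)^-1 < e.
  by move=> e0; exact: near_infty_natSinv_lt (PosNum e0).
have zcvg : (p k).1 @[k --> \oo] --> x.
  apply/cvg_enormP => e e0; near=> k.
  by have [h _ _] := pP k; apply: lt_trans h _; near: k; exact: e_small.
exists (fun k => (p k).1), (fun k => (p k).2); split => //.
- have [U xU [Ufin [K UK]]] := fL x fx.
  have Ux : U x by exact: nbhs_singleton.
  rewrite -(fineK (Ufin _ Ux)).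
  have Uz : \forall k \near \oo, U (p k).1 by exact: zcvg.
  apply: (@cvg_trans _ ((fine (f (p k).1))%:E @[k --> \oo])).
    by apply: near_eq_cvg; near=> k; rewrite fineK//; apply: Ufin; near: k.
  apply: cvg_EFin; first by near=> k.
  apply/cvgrPdist_lt => e e0; near=> k.
  have Uk : U (p k).1 by near: k.
  rewrite /= distrC; apply: le_lt_trans (UK _ _ Uk Ux) _.
  apply: (@le_lt_trans _ _ ((`|K| + 1) * enorm ((p k).1 - x))).
    by rewrite ler_wpM2r ?enorm_ge0//; have := ler_norm K; lra.
  rewrite mulrC -ltr_pdivlMr ?ltr_wpDl//; near: k.
  by move/cvg_enormP : zcvg; apply; rewrite divr_gt0// ltr_wpDl.
- by move=> k; have [] := pP k.
- apply/cvg_enormP => e e0; near=> k; rewrite subr0.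
  by have [_ h _] := pP k; apply: lt_trans h _; near: k; exact: e_small.
Unshelve. all: by end_near. Qed.

(** At its own centre the model error is bounded by [omega 0], which is 0. *)
Lemma model_gap_center f fx x (g : 'cV[R]_n -> R) :
  (-oo < f x)%E -> dom f x -> local_model f x fx ->
  (forall y, dom f y -> (g y)%:E = (fx y - f y)%E) -> g x = 0.
Proof.
move=> fNy dx [_ _ _ [omega [_ om0 _ _] om]] gE.
have ffin : f x \is a fin_num by rewrite fin_numElt fNy.
have := nbhs_singleton om dx; rewrite subrr enorm0 om0.
have -> : (f x - fx x)%E = (- g x)%:E.
  by rewrite EFinN gE// fin_num_oppeB// addeC.
by rewrite lee_fin normrN normr_le0 => /eqP.
Qed.

(** [Num.sqrt] is 0 on negative arguments, so the identity rests on the form being nonnegative,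
    which coercivity provides. *)
Lemma normA_sqr (A : 'M[R]_n) (mu : R) v : 0 < mu -> sym_eig_ge mu A ->
  normA A v ^+ 2 = dot (A *m v) v.
Proof.
move=> mu0 /sym_eig_ge_coercive /(_ v) h; rewrite /normA sqr_sqrtr//.
by apply: le_trans h; rewrite mulr_ge0 ?sqr_ge0// ltW.
Qed.

Lemma mpqn_step_spec (tau mu gmin gmax delta B : R) f fx (A : 'M[R]_n) x y
    (g : 'cV[R]_n -> R) :
  1 < tau -> 0 < mu -> 0 < gmin -> 0 < delta < 1 / 2 -> 0 <= B ->
  (forall z, (-oo < f z)%E) -> dom f x -> local_model f x fx ->
  (forall z, dom f z -> (g z)%:E = (fx z - f z)%E) ->
  (forall z, `|g z| <= B * enorm (z - x) ^+ 2) ->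
  sym_eig_ge mu A -> mpqn_step tau gmin gmax delta f fx A x y ->
  exists gamma : R, [/\ gmin <= gamma <= tau * (gmax + 2 * B / (delta * mu)),
    dom f y,
    fine (f y) + gmin * mu / 4 * enorm (y - x) ^+ 2 <= fine (f x)
    & forall z, dom f z ->
      fine (f y) + g y + gamma / 2 * dot (A *m (y - x)) (y - x) <=
      fine (f z) + g z + gamma / 2 * dot (A *m (z - x)) (z - x)].
Proof.
move=> tau1 mu0 gmin0 /andP[d0 d12] B0 fNy dx fm gE gB Amu.
have gx0 := model_gap_center _ _ _ _ (fNy x) dx fm gE.
have [[fxNy _] _ domE _] := fm.
pose fr z := fine (f z).
have fE z : dom f z -> f z = (fr z)%:E.
  by move=> dz; rewrite fineK// fin_numElt fNy.
have fxE z : dom f z -> fx z = (fr z + g z)%:E.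
  move=> dz; have fxfin : fx z \is a fin_num.
    by rewrite fin_numElt fxNy; move: dz; rewrite -domE.
  have := gE _ dz; rewrite (fE _ dz) -(fineK fxfin) -EFinB => -[->].
  by rewrite addrC subrK.
have qE z := normA_sqr A mu z mu0 Amu.
have qmu z := sym_eig_ge_coercive _ _ Amu z.
move=> [gamma0 [ik [s [/andP[g1 g2] smin snacc sacc ->]]]].
have gam0 : 0 < gamma0 by lra.
(* The subproblem value at [x] is finite, so the model cannot be infinite at a minimiser. *)
have sdom i : (i <= ik)%N -> dom f (s i).
  move=> /smin /(_ x); rewrite (fxE x dx) -EFinD => h.
  rewrite -domE /dom/=; case: (fx (s i)) h (fxNy (s i)) => [r _ _|h _|//].
    exact: ltry.
  by move: h; rewrite addye// leye_eq.
have acc i : (i <= ik)%N -> B <= delta * (tau ^+ i.+1 * gamma0 / 2) * mu ->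
    (`|f (s i) - fx (s i)| <= (delta * (tau ^+ i.+1 * gamma0 / 2) *
       normA A (s i - x) ^+ 2)%:E)%E.
  move=> iik hB; have ds := sdom i iik.
  rewrite (fE _ ds) (fxE _ ds) -EFinB lee_fin opprD addrA subrr add0r normrN.
  apply: le_trans (gB _) _; rewrite qE.
  have c0 : 0 <= delta * (tau ^+ i.+1 * gamma0 / 2).
    by rewrite mulr_ge0 ?divr_ge0 ?mulr_ge0 ?exprn_ge0//; lra.
  apply: le_trans (ler_wpM2l c0 (qmu _)).
  by rewrite [leRHS]mulrA ler_wpM2r// sqr_ge0.
pose gam := tau ^+ ik.+1 * gamma0.
have gamlo : gmin <= gam.
  apply: le_trans g1 _; rewrite /gam ler_peMl//; first exact: ltW.
  by rewrite exprn_ege1// ltW.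
have dmu : 0 < delta * mu by rewrite mulr_gt0.
have D0 : 0 <= 2 * B / (delta * mu).
  by rewrite divr_ge0 ?mulr_ge0// ltW.
have gamhi : gam <= tau * (gmax + 2 * B / (delta * mu)).
  (* Either the first trial is accepted and [gam] is [tau * gamma0], or [gam] is [tau] times a
     rejected parameter, which is at most [2 * B / (delta * mu)] since any larger one passes the
     test. The sum covers both cases. *)
  rewrite /gam; case: (ik) snacc acc => [_ _|j nacc acc].
    by rewrite expr1 ler_pM2l; lra.
  rewrite exprS -mulrA ler_pM2l; last by lra.
  rewrite leNgt; apply/negP => hbig.
  apply: (nacc j) => //; apply: acc => //.
  have : 2 * B / (delta * mu) < tau ^+ j.+1 * gamma0 by lra.
  by rewrite ltr_pdivrMr//; lra.
have dy := sdom ik (leqnn ik).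
have ymin z : dom f z -> fr (s ik) + g (s ik) +
    gam / 2 * dot (A *m (s ik - x)) (s ik - x) <=
    fr z + g z + gam / 2 * dot (A *m (z - x)) (z - x).
  move=> dz; have := smin ik (leqnn ik) z.
  by rewrite (fxE _ dz) (fxE _ dy) -!EFinD lee_fin !qE.
exists gam; split => //; first by rewrite gamlo gamhi.
(* Comparison with [x] and the acceptance test give a decrease of at least
   [(1 - delta) * gam / 2 * q]; as [delta < 1 / 2], this exceeds the quarter kept in the
   statement. *)
have := ymin x dx; rewrite gx0 subrr mulmx0 dot0r mulr0 !addr0.
move: sacc; rewrite (fE _ dy) (fxE _ dy) -EFinB lee_fin opprD addrA subrr add0r.
rewrite normrN qE -/gam -/(fr x) /= => sacc.
have h1 := ler_norm (- g (s ik)); rewrite normrN in h1.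
have h2 := qmu (s ik - x).
set q := dot _ _ in sacc h2 *.
have q0 : 0 <= q by apply: le_trans h2; rewrite mulr_ge0 ?sqr_ge0// ltW.
have h3 : gmin * (mu * enorm (s ik - x) ^+ 2) <= gam * q.
  apply: ler_pM => //; first exact: ltW.
  by rewrite mulr_ge0 ?sqr_ge0// ltW.
have h4 : 0 <= (1 / 2 - delta) * (gam * q).
  by apply: mulr_ge0; [lra|apply: mulr_ge0 => //; lra].
by move=> h5; move: sacc h1 h3 h4 h5; nra.
Qed.

End algorithm.

(** * Vanishing steps and stationarity of the limit *)

Theorem theorem4p7 (R : realType) (n : nat)
  (tau mu gmin gmax delta : R)
  (htau : 1 < tau) (hmu : 0 < mu)
  (hgmin : 0 < gmin) (hgmax : gmin <= gmax)
  (hdelta : 0 < delta < 1 / 2)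
  (f : 'cV[R]_n -> \bar R)
  (f_proper : proper_fun f) (f_lsc : lower_semicontinuous f)
  (fm : 'cV[R]_n -> 'cV[R]_n -> \bar R)
  (fm_model : forall xbar, dom f xbar -> local_model f xbar (fm xbar))
  (g : 'cV[R]_n -> 'cV[R]_n -> R)
  (g_gap : forall xbar, dom f xbar -> forall x, dom f x ->
     (g xbar x)%:E = (fm xbar x - f x)%E)
  (* Only restricts how g xbar is extended outside dom f: on dom f it follows
     from ass_f, and it is void when dom f is the whole space. *)
  (g_lsc : forall xbar, dom f xbar -> lower_semicontinuous (EFin \o g xbar))
  (H : 'cV[R]_n -> 'M[R]_n)
  (x_ : nat -> 'cV[R]_n)
  (x_gen : mpqn_sequence tau gmin gmax delta f fm H x_)
  (ass_a : bounded_below f)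
  (ass_b : forall xbar, dom f xbar -> affinely_minorized (fm xbar))
  (ass_c : continuous H /\ forall x, sym_eig_ge mu (H x))
  (ass_d : exists a : 'cV[R]_n, cluster (x_ k @[k --> \oo]) a)
  (ass_e : exists2 L : R, 0 < L &
     forall xbar, dom f xbar -> forall x,
       subdiff (EFin \o g xbar) x
         `<=` [set L *: u | u in eball 0 (enorm (x - xbar))])
  (ass_f : locally_lipschitz f)
  (phi : nat -> nat) (phi_incr : {homo phi : i j / (i < j)%N})
  (xstar : 'cV[R]_n)
  (x_cvg : x_ (phi k) @[k --> \oo] --> xstar) :
  stationary f xstar.
Proof.
have [fNy _] := f_proper; have [Hc Hmu] := ass_c; have [L L0 gsub] := ass_e.
have [x0dom x_step] := x_gen.
have gL a z v : dom f a -> regular_subdiff (EFin \o g a) z v ->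
    enorm v <= L * enorm (z - a).
  move=> da /regular_subdiff_subdiff /(gsub _ da) [u + <-].
  by rewrite /eball/= subr0 enormZ gtr0_norm// ler_pM2l.
pose Gam := tau * (gmax + 2 * (4 * L) / (delta * mu)).
have step k : dom f (x_ k) -> exists gamma : R, [/\ gmin <= gamma <= Gam,
    dom f (x_ k.+1),
    fine (f (x_ k.+1)) + gmin * mu / 4 * enorm (x_ k.+1 - x_ k) ^+ 2
      <= fine (f (x_ k))
    & forall z, dom f z ->
      fine (f (x_ k.+1)) + g (x_ k) (x_ k.+1) + gamma / 2 *
        dot (H (x_ k) *m (x_ k.+1 - x_ k)) (x_ k.+1 - x_ k) <=
      fine (f z) + g (x_ k) z +
        gamma / 2 * dot (H (x_ k) *m (z - x_ k)) (z - x_ k)].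
  move=> dk; have [_ stepk] := x_step k.
  have gE := g_gap _ dk.
  have g0 := model_gap_center _ _ _ _ (fNy _) dk (fm_model _ dk) gE.
  have B0 : 0 <= 4 * L by rewrite mulr_ge0// ltW.
  apply: (mpqn_step_spec _ _ _ _ _ _ _ _ _ _ _ _ htau hmu hgmin hdelta B0 fNy dk
    (fm_model _ dk) gE _ (Hmu _) stepk) => z.
  have := gap_quadratic_bound _ (x_ k) L (g_lsc _ dk) L0
    (fun z v => gL _ z v dk) z.
  by rewrite g0 subr0.
have xdom k : dom f (x_ k).
  by elim: k => // k /step[gamma []].
pose F k := fine (f (x_ k)).
have FE k : f (x_ k) = (F k)%:E by rewrite fineK// fin_numElt fNy; exact: xdom.
pose c := gmin * mu / 4.
have c0 : 0 < c by rewrite divr_gt0// mulr_gt0.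
have Fstep k : F k.+1 + c * enorm (x_ k.+1 - x_ k) ^+ 2 <= F k.
  by have [gamma []] := step k (xdom k).
have Fdec : nonincreasing_seq F.
  apply/nonincreasing_seqP => k; apply: le_trans (Fstep k).
  by rewrite lerDl mulr_ge0 ?sqr_ge0// ltW.
have Fcvg : cvgn F.
  apply: nonincreasing_is_cvgn => //; have [m fm_] := ass_a.
  by exists m => _ [k _ <-]; rewrite -lee_fin -FE.
have steps0 (e : R) : 0 < e -> \forall k \near \oo, enorm (x_ k.+1 - x_ k) < e.
  move=> e0.
  have diff0 : F k - F k.+1 @[k --> \oo] --> (0 : R).
    rewrite -(subrr (limn F)); apply: cvgB => //.
    by have := Fcvg; rewrite -(cvg_shiftS F).
  have ce0 : 0 < c * e ^+ 2 by rewrite mulr_gt0// exprn_gt0.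
  near=> k.
  have : F k - F k.+1 < c * e ^+ 2 by near: k; exact: cvgr_lt diff0 _ ce0.
  move=> h; have : c * enorm (x_ k.+1 - x_ k) ^+ 2 < c * e ^+ 2.
    by have := Fstep k; lra.
  by rewrite ltr_pM2l// ltr_pXn2r ?nnegrE ?enorm_ge0// ltW.
(* Were [f xstar] infinite, lower semicontinuity would push the values along the subsequence above
   [F 0], against their monotonicity. *)
have dstar : dom f xstar.
  rewrite /dom/= ltNge leye_eq; apply/negP => /eqP fstar.
  have [|V xV hV] := f_lsc xstar (F 0%N); first by rewrite fstar ltry.
  have [k _ hk] : \forall k \near \oo, V (x_ (phi k)) by exact: x_cvg.
  have := hV _ (hk k (leqnn k)); rewrite FE lte_fin ltNge.
  by rewrite Fdec.
apply: approx_stationary => // e e0.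
(* Bounds the operator norm of every [H (x_ k)] within sup-norm distance 1 of [H xstar]. *)
pose Cn := n%:R * (n%:R * (`|H xstar| + 1)).
have Cn0 : 0 <= Cn by rewrite !mulr_ge0// addr_ge0.
have Gam0 : 0 < Gam.
  have [gamma [/andP[a b] _ _ _]] := step 0%N (xdom 0%N).
  exact: lt_le_trans hgmin (le_trans a b).
(* Collects the coefficients of the three parts of the final subgradient: [u], the quadratic term
   and the proximity term. With [eta = e / (4 * K)] their total stays below [2 * K * eta = e / 2],
   and [2 <= K] keeps the distance [3 * eta] to [xstar] below [e]. *)
pose K := L + Gam * Cn + 2.
have K2 : 2 <= K.
  by rewrite /K lerDr; apply: addr_ge0; [exact: ltW|apply: mulr_ge0 => //; exact: ltW].
have K0 : 0 < K by lra.
pose eta := e / (4 * K).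
have eta0 : 0 < eta by rewrite divr_gt0// mulr_gt0.
have etaE : 4 * (K * eta) = e by rewrite /eta; field; rewrite gt_eqF.
have phi_ge k : (k <= phi k)%N.
  by elim: k => // k IH; apply: leq_ltn_trans IH _; exact: phi_incr.
have phi_oo : phi k @[k --> \oo] --> \oo.
  by move=> P [N _ NP]; exists N => // k /= Nk; apply: NP; exact: leq_trans (phi_ge k).
have [k [hk1 hk2 hk3]] : exists k, [/\ enorm (x_ k.+1 - x_ k) < eta,
    enorm (x_ k - xstar) < eta & `|H xstar - H (x_ k)| < 1].
  suff [N _ hN] : \forall k \near \oo, [/\ enorm (x_ (phi k).+1 - x_ (phi k)) < eta,
      enorm (x_ (phi k) - xstar) < eta & `|H xstar - H (x_ (phi k))| < 1].
    by exists (phi N); exact: hN (leqnn N).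
  near=> k; split; near: k.
  - exact: phi_oo _ (steps0 _ eta0).
  - by move/cvg_enormP : x_cvg; exact.
  - have /cvgrPdist_lt := cvg_comp _ _ x_cvg (Hc xstar); exact.
have dk := xdom k.
have [gamma [/andP[gam1 gam2] dk1 _ xmin]] := step k dk.
have gam0 : 0 <= gamma / 2 by rewrite divr_ge0//; lra.
pose q z := gamma / 2 * dot (H (x_ k) *m (z - x_ k)) (z - x_ k).
pose dq z := (gamma / 2) *: (2 *: (H (x_ k) *m (z - x_ k))).
have qc : continuous q.
  move=> z; apply: (@cvgM _ _ (nbhs z)); first exact: cvg_cst.
  exact: dot_mulmx_continuous.
have qe z : upper_expansion q z (dq z).
  apply: upper_expansionZ => //; apply: upper_expansion_quad.
  by have [] := Hmu (x_ k).
(* The sum rule is applied at [x_ k.+1], but the gap and the quadratic term are centred at [x_ k];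
   hence [z'] is within [2 * eta] of that centre. *)
have [z [z' [u [zx z'x gu fw]]]] :=
  fuzzy_sum_rule f (g (x_ k)) q dq _ eta ass_f dk1 (g_lsc _ dk) qc qe xmin eta0.
exists z, (- (u + dq z' + 2 *: (z' - x_ k.+1))); split => //.
  have h1 := enorm_dist (x_ k.+1) z xstar.
  have h2 := enorm_dist (x_ k) (x_ k.+1) xstar.
  have : 2 * eta <= K * eta by rewrite ler_pM2r.
  by move: etaE h1 h2 zx; lra.
have hC i j : `|H (x_ k) i j| <= `|H xstar| + 1.
  apply: le_trans (mx_coord_le_norm _ _ _ _ _ _) _.
  have -> : H (x_ k) = H xstar - (H xstar - H (x_ k)) by rewrite subKr.
  by apply: le_trans (ler_normB _ _) _; rewrite lerD2l ltW.
have C1 : 0 <= `|H xstar| + 1 by rewrite addr_ge0.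
have hH := enorm_mulmx _ (z' - x_ k) _ C1 hC; rewrite -/Cn in hH.
have hu := gL _ _ _ dk gu.
have hz := enorm_dist (x_ k.+1) z' (x_ k).
have hd : enorm (dq z') <= Gam * (Cn * enorm (z' - x_ k)).
  rewrite /dq scalerA divfK// enormZ ger0_norm; last by lra.
  by apply: ler_pM => //; [lra|exact: enorm_ge0].
rewrite enormN; have t1 := enormD (u + dq z') (2 *: (z' - x_ k.+1)).
have t2 := enormD u (dq z'); rewrite enormZ ger0_norm// in t1.
set s := enorm (z' - x_ k) in hu hz hd.
have s2 : s < 2 * eta by lra.
have h1 : L * s <= L * (2 * eta) by rewrite ler_pM2l// ltW.
have h2 : Gam * (Cn * s) <= Gam * (Cn * (2 * eta)).
  by rewrite ler_pM2l// ler_wpM2l// ltW.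
have KE : K * eta = L * eta + Gam * Cn * eta + 2 * eta by rewrite /K; ring.
have h3 : 0 <= L * eta by rewrite mulr_ge0// ltW.
have h4 : 0 <= Gam * Cn * eta.
  by apply: mulr_ge0; [apply: mulr_ge0 => //|]; exact: ltW.
by move: t1 t2 hu hd h1 h2 h3 h4 KE etaE z'x eta0; lra.
Unshelve. all: by end_near. Qed.
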